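(* Let $X$ be an infinite-dimensional complex Banach space and let $\phi:\mathcal{B}(X)\to\mathcal{B}(X)$ be a surjective map (not assumed linear or additive). Then the following are equivalent: (i) For all $T,S\in\mathcal{B}(X)$, $$K(\phi(T)\phi(S)+\phi(S)\phi(T)) = K(TS+ST).$$ (ii) There is a map $\gamma:\mathcal{B}(X)\to\mathbb{C}\setminus\{0\}$ such that $\phi(T)=\gamma(T)\,T$ for all $T\in\mathcal{B}(X)$.
   Context: $\mathcal{B}(X)$ denotes the algebra of all bounded linear operators on $X$. For $T\in\mathcal{B}(X)$, the analytic core $K(T)$ is the set of all $x\in X$ for which there exist $\delta>0$ and a sequence $(x_n)_{n\ge 0}\subset X$ with $x_0=x$, $Tx_{n+1}=x_n$ and $\|x_n\|\le \delta^n\|x\|$ for all $n\ge 0$. *)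

(* Defs.v *)
From HB Require Import structures.
From mathcomp Require Import all_boot all_algebra.
From mathcomp Require Import all_classical all_reals all_analysis.
From mathcomp Require Import complex.
Set Implicit Arguments. Unset Strict Implicit. Unset Printing Implicit Defensive.
Import GRing.Theory Num.Theory.
Import numFieldNormedType.Exports.
Local Open Scope ring_scope.
Local Open Scope classical_set_scope.
Local Open Scope complex_scope.

Record bop (R : realType) (X : normedModType R[i]) := BOP {
  bop_fun : {linear X -> X};
  bop_cont : continuous bop_fun }.

Definition bop_app (R : realType) (X : normedModType R[i]) (T : bop X) : X -> X :=
  fun x => bop_fun T x.
Coercion bop_app : bop >-> Funclass.

Definition infinite_dimensional (R : realType) (X : normedModType R[i]) : Prop :=
  forall (n : nat) (v : 'I_n -> X),
    exists x : X, forall c : 'I_n -> R[i], x <> \sum_(i < n) c i *: v i.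

Definition anticomm (R : realType) (X : normedModType R[i]) (T S : bop X) : X -> X :=
  fun x => T (S x) + S (T x).

Definition analytic_core (R : realType) (X : normedModType R[i]) (T : X -> X) : set X :=
  [set x | exists (delta : R[i]), 0 < delta /\
     exists xs : nat -> X, xs 0%N = x /\
       forall n : nat, T (xs n.+1) = xs n /\ `|xs n| <= delta ^+ n * `|x| ].

(* Main.v *)
Require Import Defs.
From HB Require Import structures.
From mathcomp Require Import all_boot all_order all_algebra.
From mathcomp Require Import all_classical all_reals all_analysis.
From mathcomp Require Import complex ring lra.
Import GRing.Theory Num.Theory.
Import numFieldNormedType.Exports.
Local Open Scope ring_scope.
Local Open Scope classical_set_scope.
Local Open Scope complex_scope.

(* Everything is tested against rank-one operators, which the Hahn-Banach theorem
   provides. An operator T has rank at most one iff K(TS+ST) lies in a plane for every S: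
   when T has rank two, a finite-rank S can be interpolated on a few independent vectors so
   that TS+ST is invertible on a three-dimensional subspace. Hence phi preserves rank one,
   and comparing K(PS+SP) for rank-one P, S shows that phi P is a multiple of P whenever
   P = x (x) f with f x = 1. So phi T and T satisfy K(TP+PT) = K(phi(T)P+P phi(T)) for all
   those P. If f(T^2 x) = f(Tx)^2 = t^2, the operator TP+PT is degenerate on span(x, Tx) and
   its core is the line through Tx+tx, so the line through Tx is recovered from the cores:
   phi(T)x is a nonzero multiple of Tx for every x, and linearity makes the factor
   independent of x. *)

Set Implicit Arguments. Unset Strict Implicit. Unset Printing Implicit Defensive.
Import Order.TTheory.

(** * Linear equations in modules *)

Section ModuleExpressions.
Variables (K : comNzRingType) (V : lmodType K).

(** Syntax for linear combinations of numbered atoms: comparing coefficients turns a vector identity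
    into scalar identities for [ring] and [field]. *)
Inductive vexp :=
  VAtom of nat | VZero | VAdd of vexp & vexp | VOpp of vexp | VScale of K & vexp.

Fixpoint veval (env : seq V) (e : vexp) : V :=
  match e with
  | VAtom i => nth 0 env i
  | VZero => 0
  | VAdd e1 e2 => veval env e1 + veval env e2
  | VOpp e1 => - veval env e1
  | VScale a e1 => a *: veval env e1
  end.

Fixpoint vcoef (i : nat) (e : vexp) : K :=
  match e with
  | VAtom j => if eqn i j then 1 else 0
  | VZero => 0
  | VAdd e1 e2 => vcoef i e1 + vcoef i e2
  | VOpp e1 => - vcoef i e1
  | VScale a e1 => a * vcoef i e1
  end.

Lemma vevalE env e : veval env e = \sum_(i < size env) vcoef i e *: nth 0 env i.
Proof.
elim: e => [j||e1 IH1 e2 IH2|e IH|a e IH] /=.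
- have [jlt|jge] := ltnP j (size env); last first.
    rewrite nth_default // big1 // => i _.
    by case: eqnP => [ij|_]; [move: (ltn_ord i); rewrite ij ltnNge jge | rewrite scale0r].
  rewrite (bigD1 (Ordinal jlt)) //= big1 ?addr0.
    by case: eqnP => // _; rewrite scale1r.
  move=> i ij; case: eqnP => [eij|_]; last by rewrite scale0r.
  by case/eqP: ij; apply/val_inj.
- by rewrite big1 // => i _; rewrite scale0r.
- by rewrite IH1 IH2 -big_split; apply: eq_bigr => i _; rewrite scalerDl.
- by rewrite IH -sumrN; apply: eq_bigr => i _; rewrite scaleNr.
- by rewrite IH scaler_sumr; apply: eq_bigr => i _; rewrite scalerA.
Qed.

Fixpoint vcoefs_eq (n : nat) (e1 e2 : vexp) : Prop :=
  if n is m.+1 then vcoefs_eq m e1 e2 /\ vcoef m e1 = vcoef m e2 else True.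

Lemma veval_eq env e1 e2 :
  vcoefs_eq (size env) e1 e2 -> veval env e1 = veval env e2.
Proof.
rewrite !vevalE; elim: (size env) => [|n IH] /=; first by rewrite !big_ord0.
by case=> /IH ih e; rewrite !big_ord_recr /= ih e.
Qed.

End ModuleExpressions.

Ltac vindex x env :=
  lazymatch env with
  | cons x _ => constr:(0%N)
  | cons _ ?env' => let n := vindex x env' in constr:(S n)
  end.

Ltac vatoms t env :=
  lazymatch t with
  | @GRing.add _ ?a ?b => let env := vatoms a env in vatoms b env
  | @GRing.opp _ ?a => vatoms a env
  | @GRing.scale _ _ _ ?a => vatoms a env
  | @GRing.zero _ => env
  | _ => match env with
         | _ => let _ := vindex t env in env
         | _ => constr:(cons t env)
         end
  end.

Ltac vreify K t env :=
  lazymatch t with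
  | @GRing.add _ ?a ?b =>
      let a := vreify K a env in let b := vreify K b env in constr:(@VAdd K a b)
  | @GRing.opp _ ?a => let a := vreify K a env in constr:(@VOpp K a)
  | @GRing.scale _ _ ?c ?a => let a := vreify K a env in constr:(@VScale K c a)
  | @GRing.zero _ => constr:(@VZero K)
  | _ => let n := vindex t env in constr:(@VAtom K n)
  end.

(* [vec_eq K V] reduces an equation in the [K]-module [V] to the equations
   between the coefficients of the two sides at each atom. *)
Ltac vec_eq K V :=
  lazymatch goal with
  | |- ?l = ?r =>
    let env := vatoms l constr:(@nil V) in
    let env := vatoms r env in
    let el := vreify K l env in
    let er := vreify K r env in
    apply: (@veval_eq K V env el er); cbn [size vcoefs_eq vcoef eqn]; do ?split
  end.

(** * The Hahn-Banach theorem *)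

Section HahnBanach.
Variables (R : realType) (X : lmodType R[i]) (p : X -> R).
Hypothesis pD : forall u v, p (u + v) <= p u + p v.
Hypothesis pZ : forall (r : R) u, 0 <= r -> p (r%:C *: u) = r * p u.

Let p0 : p 0 = 0.
Proof. by have := @pZ 0 0 (lexx 0); rewrite scaler0 mul0r. Qed.

(* Graphs of real-linear functionals on subspaces that are dominated by [p];
   the domination makes such a graph single-valued. *)
Definition dominated_graph (G : set (X * R)) :=
  (forall (r : R) w1 w2, G w1 -> G w2 ->
     G (r%:C *: w1.1 + w2.1, r * w1.2 + w2.2)) /\
  (forall w, G w -> w.2 <= p w.1).

Lemma dominated_graph0 G w : dominated_graph G -> G w -> G (0, 0).
Proof.
case=> GL _ Gw; have := GL (-1) w w Gw Gw.
by rewrite rmorphN rmorph1 scaleN1r addNr mulN1r addNr.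
Qed.

Lemma dominated_graphZ G (r : R) w :
  dominated_graph G -> G w -> G (r%:C *: w.1, r * w.2).
Proof.
move=> dG Gw; have := dG.1 r w (0, 0) Gw (dominated_graph0 dG Gw).
by rewrite /= !addr0.
Qed.

(** By subadditivity each [w.2 - p (w.1 - v)] lies below each [p (w'.1 + v) - w'.2], so the supremum
    of the former is an admissible value at [v]. Homogeneity reduces a nonzero [r] to [1] or
    [-1]. *)
Lemma dominated_extension_value G w0 v : dominated_graph G -> G w0 ->
  exists c, forall w (r : R), G w -> w.2 + r * c <= p (w.1 + r%:C *: v).
Proof.
move=> dG Gw0; have [GL Gp] := dG; have G0 := dominated_graph0 dG Gw0.
pose L := [set a | exists2 w, G w & a = w.2 - p (w.1 - v)].
have Lub w' : G w' -> ubound L (p (w'.1 + v) - w'.2).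
  move=> Gw' _ [w Gw ->].
  have := Gp _ (GL 1 w w' Gw Gw'); rewrite /= rmorph1 scale1r mul1r => h.
  have := pD (w.1 - v) (w'.1 + v).
  have -> : w.1 - v + (w'.1 + v) = w.1 + w'.1 by rewrite addrACA addNr addr0.
  lra.
have Lsup : has_sup L.
  by split; [exists (0 - p (0 - v)), (0, 0) | exists (p (0 + v) - 0); exact: (Lub (0, 0))].
exists (sup L) => w r Gw.
have [r0|r0|<-] := ltgtP 0 r; last by rewrite mul0r addr0 rmorph0 scale0r addr0; exact: Gp.
- have Gw' := dominated_graphZ r^-1 dG Gw.
  have /= := ge_sup Lsup.1 (Lub _ Gw'); rewrite lerBrDl => h.
  have -> : w.1 + r%:C *: v = r%:C *: ((r^-1)%:C *: w.1 + v).
    by rewrite scalerDr scalerA -rmorphM /= divff ?gt_eqF // rmorph1 scale1r.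
  rewrite (pZ _ (ltW r0)) -ler_pdivrMl //; apply: le_trans h.
  by rewrite mulrDr mulrA mulVf ?gt_eqF // mul1r.
- have s0 : 0 < - r by rewrite oppr_gt0.
  have Gw' := dominated_graphZ (- r)^-1 dG Gw.
  have h : (- r)^-1 * w.2 - p (((- r)^-1)%:C *: w.1 - v) <= sup L.
    by apply: (ub_le_sup Lsup.2); exists (((- r)^-1)%:C *: w.1, (- r)^-1 * w.2).
  have -> : w.1 + r%:C *: v = (- r)%:C *: (((- r)^-1)%:C *: w.1 - v).
    rewrite scalerBr scalerA -rmorphM /= divff ?gt_eqF // rmorph1 scale1r.
    by rewrite rmorphN /= scaleNr opprK.
  rewrite (pZ _ (ltW s0)) -ler_pdivrMl //.
  rewrite mulrDr invrN mulNr (mulNr _ (r * _)) (mulrA r^-1 r) mulVf ?lt_eqF // mul1r.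
  move: h; rewrite invrN; lra.
Qed.

Lemma dominated_extension G w0 v : dominated_graph G -> G w0 ->
  exists2 G', dominated_graph G' & G `<=` G' /\ exists c, G' (v, c).
Proof.
move=> dG Gw0; have [c cP] := dominated_extension_value v dG Gw0.
have G0 := dominated_graph0 dG Gw0.
exists [set w | exists w1 (r : R), G w1 /\ w = (w1.1 + r%:C *: v, w1.2 + r * c)].
  split=> [s _ _ [w1 [r1 [G1 ->]]] [w2 [r2 [G2 ->]]]|_ [w1 [r [G1 ->]]]] /=; last exact: cP.
  exists (s%:C *: w1.1 + w2.1, s * w1.2 + w2.2), (s * r1 + r2); split; first exact: dG.1.
  congr pair => /=; last by ring.
  by rewrite rmorphD rmorphM /=; vec_eq R[i] X; ring.
split=> [w Gw|].
  by exists w, 0; split => //; rewrite rmorph0 scale0r mul0r !addr0 -surjective_pairing.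
by exists c, (0, 0), 1; split => //=; rewrite rmorph1 scale1r mul1r !add0r.
Qed.

Theorem real_hahn_banach (x : X) : exists g : X -> R,
  [/\ (forall u v, g (u + v) = g u + g v),
      (forall (r : R) u, g (r%:C *: u) = r * g u),
      (forall u, g u <= p u) & g x = p x].
Proof.
pose line := [set w | exists r : R, w = (r%:C *: x, r * p x)].
have dline : dominated_graph line.
  split=> [s _ _ [r1 ->] [r2 ->]|_ [r ->]] /=.
    exists (s * r1 + r2); congr pair; last by ring.
    by rewrite rmorphD rmorphM /=; vec_eq R[i] X; ring.
  have [r0|r0] := leP 0 r; first by rewrite pZ.
  have -> : r%:C *: x = (- r)%:C *: (- x) by rewrite rmorphN /= scaleNr scalerN opprK.
  rewrite pZ; last by rewrite oppr_ge0 ltW.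
  have h : 0 <= p x + p (- x) by rewrite -p0 -(subrr x) pD.
  by rewrite -subr_le0 mulNr opprK -mulrDr nmulr_rle0.
(* The union of the empty chain is empty, so [P] demands the point [(x, p x)] only of nonempty
   graphs; comparison with [line] then shows that the maximal graph is nonempty. *)
pose P G := dominated_graph G /\ forall w, G w -> G (x, p x).
have Pline : P line.
  by split=> // w _; exists 1; rewrite rmorph1 scale1r mul1r.
have [|G [[dG Gx] Gmax]] := @Zorn_bigcup _ P.
  move=> F FP Ftot; split; last by move=> w [G FG Gw]; exists G => //; apply: (FP _ FG).2 Gw.
  split=> [r w1 w2 [G1 F1 Gw1] [G2 F2 Gw2]|w [G FG Gw]]; last exact: (FP _ FG).1.2.
  have [G12|G21] := Ftot _ _ F1 F2.
    by exists G2 => //; apply: (FP _ F2).1.1 => //; exact: G12.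
  by exists G1 => //; apply: (FP _ F1).1.1 => //; exact: G21.
have [w0 Gw0] : exists w, G w.
  apply: contrapT => /forallNP G0; apply: (Gmax line) => //; split.
    by move=> w /G0.
  move=> /(_ (x, p x)) lG; apply/(G0 (x, p x))/lG.
  by exists 1; rewrite rmorph1 scale1r mul1r.
have total v : exists a, G (v, a).
  have [G' dG' [GG' [c G'v]]] := dominated_extension v dG Gw0.
  apply: contrapT => nG; apply: (Gmax G').
    by split=> // G'G; apply: nG; exists c; apply: G'G.
  by split=> // w _; apply/GG'/(Gx w0).
have uniq v a b : G (v, a) -> G (v, b) -> a = b.
  move=> Ga Gb; apply/eqP; rewrite eq_le.
  have le c d : G (v, c) -> G (v, d) -> c <= d.
    move=> Gc Gd; have := dG.2 _ (dG.1 (-1) _ _ Gd Gc).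
    by rewrite /= rmorphN rmorph1 scaleN1r addNr p0; lra.
  by rewrite !le.
have [g gP] := choice total; exists g; split.
- move=> u v; apply: uniq (gP _) _.
  by have := dG.1 1 _ _ (gP u) (gP v); rewrite /= rmorph1 scale1r mul1r.
- by move=> r u; apply: uniq (gP _) _; apply: dominated_graphZ dG (gP u).
- by move=> u; apply: dG.2 (gP u).
- by apply: uniq (gP _) (Gx w0 Gw0).
Qed.

End HahnBanach.

Definition bounded_form (R : realType) (X : normedModType R[i]) (f : X -> R[i]) :=
  (forall a u v, f (a *: u + v) = a * f u + f v) /\
  exists2 M, 0 <= M & forall v, `|f v| <= M * `|v|.

Theorem separating_form (R : realType) (X : normedModType R[i]) (x : X) :
  x != 0 -> exists2 f, bounded_form f & f x = 1.
Proof.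
move=> x0.
have nE (v : X) : (complex.Re `|v|)%:C = `|v| by apply/RRe_real/normr_real.
have [|r u r0|g [gD gZ gp gx]] := @real_hahn_banach R X (fun v => complex.Re `|v|) _ _ x.
- by move=> u v; rewrite -lecR rmorphD /= !nE ler_normD.
- by apply: complexI; rewrite rmorphM /= !nE normrZ ger0_norm // ler0c.
have gN u : g (- u) = - g u by have := gZ (-1) u; rewrite rmorphN rmorph1 scaleN1r mulN1r.
have gabs u : `|(g u)%:C| <= `|u|.
  have g1 := gp u; have g2 := gp (- u); rewrite normrN gN in g2.
  rewrite -nE; move: g1 g2; rewrite -!lecR => g1 g2.
  rewrite real_ler_norml ?g1 ?andbT; last by apply/complex_realP; exists (g u).
  by rewrite lerNl -rmorphN.
(* The complex-linear form with real part [g]. Each of its two terms is bounded by the norm, whence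
   the factor 2 below; [h x] is nonzero because its real part is the norm of [x]. *)
pose h v := (g v)%:C - 'i * (g ('i *: v))%:C.
have hD u v : h (u + v) = h u + h v.
  by rewrite /h scalerDr !gD !rmorphD /=; ring.
have hR (r : R) u : h (r%:C *: u) = r%:C * h u.
  by rewrite /h scalerA (mulrC 'i r%:C) -scalerA !gZ !rmorphM /=; ring.
have i2 : 'i * 'i = -1 :> R[i] by rewrite -expr2 sqr_i.
have hi u : h ('i *: u) = 'i * h u.
  rewrite /h scalerA i2 scaleN1r gN rmorphN /= mulrBr mulrA i2.
  by ring.
have hZ a u : h (a *: u) = a * h u.
  by rewrite [a in LHS]complexE scalerDl hD hR -scalerA hi hR [a in RHS]complexE mulrDl -mulrA.
have hx : h x != 0.
  apply/eqP => /(congr1 (@complex.Re R)); rewrite /h /= gx.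
  rewrite !(mul0r, mul1r, mulr0, subr0, oppr0, addr0, add0r).
  move=> n0; case/negP: x0; rewrite -normr_eq0 -nE n0; exact: eqxx.
exists (fun v => (h x)^-1 * h v); last by rewrite mulVf.
split=> [a u v|]; first by rewrite hD hZ; ring.
exists (`|(h x)^-1| * 2) => [|v]; first by rewrite mulr_ge0.
rewrite normrM -mulrA ler_wpM2l //.
rewrite (le_trans (ler_normB _ _)) // normrM.
have i1 : `|'i : R[i]| = 1.
  by apply/eqP; rewrite -(@pexpr_eq1 _ _ 2) // -normrX sqr_i normrN1.
have := gabs ('i *: v); rewrite normrZ i1 !mul1r => g2; rewrite mulr_natl mulr2n; exact: lerD.
Qed.

(** * Interpolation by finite-rank operators, and analytic cores *)

Section Operators.
Variables (R : realType) (X : normedModType R[i]).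
Implicit Types (T S : bop X) (s : seq X) (f : X -> R[i]) (A : X -> X).

Lemma bopP T a u v : T (a *: u + v) = a *: T u + T v.
Proof. exact: linearP. Qed.

Lemma bopD T u v : T (u + v) = T u + T v.
Proof. exact: linearD. Qed.

Lemma bopZ T a u : T (a *: u) = a *: T u.
Proof. exact: linearZ. Qed.

Lemma bopN T u : T (- u) = - T u.
Proof. exact: linearN. Qed.

Lemma bop0 T : T 0 = 0.
Proof. exact: linear0. Qed.

Definition bopE := (bopD, bopZ, bopN, bop0).

Lemma bop_of_bounded (g : X -> X) :
  (forall a u v, g (a *: u + v) = a *: g u + g v) ->
  (exists2 M, 0 <= M & forall v, `|g v| <= M * `|v|) ->
  exists T : bop X, forall v, T v = g v.
Proof.
move=> glin [M M0 gM].
pose gl : {linear X -> X} := HB.pack g (GRing.isLinear.Build _ _ _ _ g glin).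
suff gc : continuous gl by exists (BOP gc).
apply: bounded_linear_continuous; apply/linear_boundedP.
near=> r => v; apply: (le_trans (gM v)); rewrite ler_wpM2r //.
by near: r; apply: nbhs_pinfty_ge; exact: ger0_real.
Unshelve. all: by end_near. Qed.

Lemma bop_bounded T : exists2 M, 0 <= M & forall v, `|T v| <= M * `|v|.
Proof.
have /linear_bounded_continuous/linear_boundedP := @bop_cont _ _ T.
by case/pinfty_ex_gt0 => M M0 TM; exists M => //; exact: ltW.
Qed.

Lemma bop_id : exists T : bop X, forall v, T v = v.
Proof. by apply: bop_of_bounded => //; exists 1 => // v; rewrite mul1r. Qed.

Lemma bop_zero : exists T : bop X, forall v, T v = 0.
Proof.
apply: bop_of_bounded => [a u v|]; first by rewrite scaler0 addr0.
by exists 0 => // v; rewrite mul0r normr0.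
Qed.

Lemma bop_add_rank1 T f x : bounded_form f ->
  exists S : bop X, forall v, S v = T v + f v *: x.
Proof.
case=> flin [M M0 fM]; have [N N0 TN] := bop_bounded T.
apply: bop_of_bounded => [a u v|]; first by rewrite bopP flin; vec_eq R[i] X; ring.
exists (N + M * `|x|) => [|v]; first by rewrite addr_ge0 // mulr_ge0.
apply: (le_trans (ler_normD _ _)); rewrite mulrDl; apply: lerD => //.
rewrite normrZ mulrAC ler_wpM2r ?fM //.
Qed.

Lemma bop_rank1 f x : bounded_form f -> exists S : bop X, forall v, S v = f v *: x.
Proof.
have [T T0] := bop_zero => /(bop_add_rank1 T x)[S SP].
by exists S => v; rewrite SP T0 add0r.
Qed.

Lemma formD f u v : bounded_form f -> f (u + v) = f u + f v.
Proof. by case=> fl _; rewrite -[u]scale1r fl mul1r scale1r. Qed.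

Lemma form0 f : bounded_form f -> f 0 = 0.
Proof. by move=> [fl _]; have := fl (-1) 0 0; rewrite scaler0 addr0 mulN1r addNr. Qed.

Lemma formZ f a u : bounded_form f -> f (a *: u) = a * f u.
Proof. by move=> ff; rewrite -[a *: u]addr0 ff.1 (form0 ff) addr0. Qed.

Lemma formN f u : bounded_form f -> f (- u) = - f u.
Proof. by move=> ff; rewrite -scaleN1r formZ // mulN1r. Qed.

Lemma bounded_form_comb f g a : bounded_form f -> bounded_form g ->
  bounded_form (fun v => f v + a * g v).
Proof.
case=> fl [M M0 fM] [gl [N N0 gN]]; split=> [b u v|]; first by rewrite fl gl; ring.
exists (M + `|a| * N) => [|v]; first by rewrite addr_ge0 // mulr_ge0.
apply: (le_trans (ler_normD _ _)); rewrite mulrDl; apply: lerD => //.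
by rewrite normrM -mulrA ler_wpM2l ?gN.
Qed.

(** Recursion on the list, rather than finite sums, lets forms and operators be built by peeling off
    the head. *)
Fixpoint in_span s v : Prop :=
  if s is e :: s' then exists a, in_span s' (v - a *: e) else v = 0.

Fixpoint lfree s : Prop :=
  if s is e :: s' then ~ in_span s' e /\ lfree s' else True.

Lemma in_span0 s : in_span s 0.
Proof. by elim: s => //= e s IH; exists 0; rewrite scale0r subr0. Qed.

Lemma in_span_comb s a u v : in_span s u -> in_span s v -> in_span s (a *: u + v).
Proof.
elim: s u v => [|e s IH] u v /=; first by move=> -> ->; rewrite scaler0 addr0.
move=> [b hu] [c hv]; exists (a * b + c).
have := IH _ _ hu hv; congr in_span; by vec_eq R[i] X; ring.
Qed.

Lemma in_spanZ s a u : in_span s u -> in_span s (a *: u).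
Proof. by move=> su; rewrite -[_ *: _]addr0; apply: in_span_comb (in_span0 s). Qed.

Lemma in_spanD s u v : in_span s u -> in_span s v -> in_span s (u + v).
Proof. by move=> su; rewrite -[u]scale1r; exact: in_span_comb. Qed.

Lemma in_span_cons s e v : in_span s v -> in_span (e :: s) v.
Proof. by move=> sv; exists 0; rewrite scale0r subr0. Qed.

Lemma in_span_head s e : in_span (e :: s) e.
Proof. by exists 1; rewrite scale1r subrr; exact: in_span0. Qed.

Lemma in_span_sum s v : in_span s v ->
  exists c : 'I_(size s) -> R[i], v = \sum_(i < size s) c i *: s`_i.
Proof.
elim: s v => [|e s IH] v /=; first by move=> ->; exists (fun=> 0); rewrite big_ord0.
move=> [a /IH[c cP]].
exists (fun i => oapp c a (unlift ord0 i)); rewrite big_ord_recl unlift_none /=.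
under eq_bigr => i _ do rewrite liftK /=.
by rewrite -cP addrC subrK.
Qed.

Lemma infinite_dimensional_nspan s : infinite_dimensional X -> exists x, ~ in_span s x.
Proof.
move=> /(_ (size s) (fun i => s`_i))[x xP]; exists x => /in_span_sum[c].
exact: xP.
Qed.

(** Induction on the list. A head [e] dependent on the tail is dropped. Otherwise take [k] with
    [k e = 1] that vanishes on the tail, apply induction to [x - k x *: e], and correct the form [f]
    so obtained to [f - f e * k], which also kills [e]. *)
Lemma annihilator s x : ~ in_span s x ->
  exists2 f, bounded_form f & f x = 1 /\ forall v, in_span s v -> f v = 0.
Proof.
elim: s x => [|e s IH] x nx.
  have /separating_form[f fb fx] : x != 0 by apply/eqP.
  by exists f => //; split=> // v ->; rewrite form0.
have [se|nse] := pselect (in_span s e).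
  have [|f fb [fx fs]] := IH x; first by move=> /(in_span_cons e).
  exists f => //; split=> // v [a sv]; apply: fs.
  by rewrite -(subrK (a *: e) v); apply: in_spanD => //; exact: in_spanZ.
have [k kb [ke ks]] := IH e nse.
have [|f fb [fx fs]] := IH (x - k x *: e); first by move=> sx; apply: nx; exists (k x).
exists (fun v => f v + - f e * k v); first exact: bounded_form_comb.
split; first by rewrite -fx formD // formN // formZ //; ring.
move=> v [a sv]; rewrite -(subrK (a *: e) v) (formD _ _ fb) (formD _ _ kb).
rewrite (fs _ sv) (ks _ sv) !formZ // ke.
by ring.
Qed.

Fixpoint interpolates (Y : Type) (g : X -> Y) (t : seq (X * Y)) : Prop :=
  if t is w :: t' then g w.1 = w.2 /\ interpolates g t' else True.

Lemma interpolates_ext (Y : Type) (g g' : X -> Y) (t : seq (X * Y)) :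
  (forall v, in_span (unzip1 t) v -> g v = g' v) -> interpolates g t -> interpolates g' t.
Proof.
elim: t => //= w t IH gg' [gw gt]; split; first by rewrite -gg' //; exact: in_span_head.
by apply: IH gt => v tv; apply: gg'; exact: in_span_cons.
Qed.

Lemma form_interpolation (t : seq (X * R[i])) : lfree (unzip1 t) ->
  exists2 f, bounded_form f & interpolates f t.
Proof.
elim: t => [_|[e c] t IH /= [ne /IH[f fb ft]]].
  exists (fun=> 0) => //; split=> [a u v|]; first by ring.
  by exists 0 => // v; rewrite normr0 mul0r.
have [k kb [ke kt]] := annihilator ne.
exists (fun v => f v + (c - f e) * k v); first exact: bounded_form_comb.
split; first by rewrite ke; ring.
by apply: interpolates_ext ft => v /kt ->; rewrite mulr0 addr0.
Qed.

(** Confining the range to the span of the prescribed values controls [S] where no value is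
    prescribed, as at [T (T (T x))] in [large_core_cyclic]. *)
Lemma bop_interpolation (t : seq (X * X)) : lfree (unzip1 t) ->
  exists2 S : bop X, interpolates S t & forall v, in_span (unzip2 t) (S v).
Proof.
elim: t => [_|[e y] t IH /= [ne /IH[S St rS]]].
  by have [S S0] := bop_zero; exists S.
have [k kb [ke kt]] := annihilator ne.
have [S' S'P] := bop_add_rank1 S (y - S e) kb; exists S'.
  split; first by rewrite S'P ke scale1r addrC subrK.
  by apply: interpolates_ext St => v /kt kv; rewrite S'P kv scale0r addr0.
move=> v; exists (k v).
have -> : S' v - k v *: y = (- k v) *: S e + S v by rewrite S'P; vec_eq R[i] X; ring.
exact: in_span_comb.
Qed.

(** * Analytic cores of linear maps *)

Definition linmap A := forall a u v, A (a *: u + v) = a *: A u + A v.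

Lemma linmap0 A : linmap A -> A 0 = 0.
Proof. by move=> /(_ (-1) 0 0); rewrite scaler0 addr0 scaleN1r addNr. Qed.

Lemma linmapZ A a u : linmap A -> A (a *: u) = a *: A u.
Proof. by move=> lA; rewrite -[a *: u]addr0 lA linmap0 // addr0. Qed.

Lemma linmap_sum A n (c : 'I_n -> R[i]) (e : 'I_n -> X) : linmap A ->
  A (\sum_i c i *: e i) = \sum_i c i *: A (e i).
Proof.
move=> lA; elim: n c e => [|n IH] c e; first by rewrite !big_ord0 linmap0.
by rewrite !big_ord_recl lA IH.
Qed.

Lemma anticomm_linear T S : linmap (anticomm T S).
Proof. by move=> a u v; rewrite /anticomm !bopP; vec_eq R[i] X; ring. Qed.

Lemma core0 A : A 0 = 0 -> analytic_core A 0.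
Proof.
move=> A0; exists 1; split=> //; exists (fun=> 0); split=> // n; split=> //.
by rewrite normr0 mulr0.
Qed.


(* The constant [M] is absorbed into the base of the geometric bound. *)
Lemma core_of_growth A (xs : nat -> X) (M B : R[i]) : A 0 = 0 -> 0 <= M -> 0 <= B ->
  (forall n, A (xs n.+1) = xs n) -> (forall n, `|xs n| <= M * B ^+ n) ->
  analytic_core A (xs 0%N).
Proof.
move=> A0 M0 B0 xsA xsM; have [->|x0] := eqVneq (xs 0%N) 0; first exact: core0.
have nx : 0 < `|xs 0%N| by rewrite normr_gt0.
have Mx : 0 <= M / `|xs 0%N| by rewrite divr_ge0.
exists ((M / `|xs 0%N| + 1) * (B + 1)); split.
  by rewrite mulr_gt0 // ltr_wpDl.
exists xs; split=> // -[|n]; split=> //; first by rewrite expr0 mul1r.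
rewrite (le_trans (xsM n.+1)) // exprMn mulrAC; apply: ler_pM => //; first exact: exprn_ge0.
  rewrite -ler_pdivrMr // exprS (@le_trans _ _ (M / `|xs 0%N| + 1)) //.
    by rewrite lerDl.
  by rewrite ler_peMr ?addr_ge0 // exprn_ege1 // lerDr.
by apply: lerXn2r; rewrite ?nnegrE ?addr_ge0 // lerDl.
Qed.

(** The generators have preimages inside the span, so iterating a linear choice of preimages gives a
    backward orbit that stays in the span and grows at most geometrically. *)
Lemma core_span A s : linmap A ->
  (forall y, y \in s -> exists2 v, in_span s v & A v = y) ->
  forall v, in_span s v -> analytic_core A v.
Proof.
move=> lA sA v /in_span_sum[c ->].
set n := size s in c *.
have preim (i : 'I_n) : exists d : 'I_n -> R[i], A (\sum_j d j *: s`_j) = s`_i.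
  have [u /in_span_sum[d ->] Au] := sA s`_i (mem_nth 0 (ltn_ord i)).
  by exists d.
have [N NP] := choice preim.
(* [step] takes the coordinates of a vector to those of its chosen preimage; [L] below bounds it in
   the sum norm [sz]. *)
pose step (d : 'I_n -> R[i]) j := \sum_i d i * N i j.
pose comb (d : 'I_n -> R[i]) := \sum_j d j *: s`_j.
have stepA d : A (comb (step d)) = comb d.
  rewrite /comb /step (_ : \sum_j _ = \sum_i d i *: (\sum_j N i j *: s`_j)).
    by rewrite linmap_sum //; apply: eq_bigr => i _; rewrite NP.
  under eq_bigr => j _ do rewrite scaler_suml.
  rewrite exchange_big; apply: eq_bigr => i _ /=.
  by rewrite scaler_sumr; apply: eq_bigr => j _; rewrite scalerA.
pose L := \sum_i \sum_j `|N i j|; pose sz (d : 'I_n -> R[i]) := \sum_i `|d i|.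
have sz_ge0 d : 0 <= sz d by apply: sumr_ge0.
have stepL d : sz (step d) <= sz d * L.
  rewrite /sz /step mulr_suml.
  apply: (@le_trans _ _ (\sum_j \sum_i `|d i| * `|N i j|)).
    apply: ler_sum => j _; rewrite (le_trans (ler_norm_sum _ _ _)) //.
    by under eq_bigr do rewrite normrM.
  rewrite exchange_big; apply: ler_sum => i _ /=; rewrite -mulr_sumr ler_wpM2l //.
  by rewrite /L [leRHS](bigD1 i) //= lerDl; apply: sumr_ge0 => k _; apply: sumr_ge0.
have combE d : `|comb d| <= sz d * (\sum_(j < n) `|s`_j|).
  rewrite /comb /sz (le_trans (ler_norm_sum _ _ _)) // mulr_suml.
  apply: ler_sum => i _; rewrite normrZ ler_wpM2l //.
  by rewrite (bigD1 i) //= lerDl; apply: sumr_ge0.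
have L0 : 0 <= L by apply: sumr_ge0 => i _; apply: sumr_ge0.
have E0 : 0 <= \sum_(j < n) `|s`_j| by apply: sumr_ge0.
have := @core_of_growth A (fun k => comb (iter k step c)) (sz c * \sum_(j < n) `|s`_j|) L
  (linmap0 lA).
apply => // [|k|k]; first exact: mulr_ge0.
  exact: stepA.
apply: (le_trans (combE _)); rewrite mulrAC ler_wpM2r //.
elim: k => [|k IH]; first by rewrite expr0 mulr1.
by rewrite iterS (le_trans (stepL _)) // exprSr mulrA ler_wpM2r.
Qed.

Lemma core_eigen A v c : linmap A -> c != 0 -> A v = c *: v -> analytic_core A v.
Proof.
move=> lA c0 Av; apply: (@core_span _ [:: v]) (in_span_head _ _) => // y.
rewrite inE => /eqP ->; exists (c^-1 *: v); first exact/in_spanZ/in_span_head.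
by rewrite linmapZ // Av scalerA mulVf // scale1r.
Qed.

(** Upper bounds on cores are obtained from this by bounding the range of the first, second or third
    power. *)
Lemma core_iter A n v : analytic_core A v -> exists u, iter n A u = v.
Proof.
case=> d [_ [xs [xs0 xsA]]]; exists (xs n); rewrite -xs0.
by elim: n => // n IH; rewrite iterSr (xsA n).1.
Qed.

(** A backward orbit [xs] of [A] becomes the backward orbit [c ^+ n *: xs n] of [B]; the growth rate
    gains the factor [|c|]. *)
Lemma core_scale A B c : c != 0 -> (forall v, A v = c *: B v) -> linmap B ->
  analytic_core A `<=` analytic_core B.
Proof.
move=> c0 AB lB v [d [d0 [xs [xs0 xsA]]]].
exists (d * `|c|); split; first by rewrite mulr_gt0 // normr_gt0.
exists (fun n => c ^+ n *: xs n); split=> [|n]; first by rewrite expr0 scale1r.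
split; last first.
  rewrite normrZ normrX exprMn (mulrC (d ^+ n)) -mulrA.
  by rewrite ler_wpM2l ?exprn_ge0 // (xsA n).2.
by rewrite linmapZ // exprSr -scalerA -AB (xsA n).1.
Qed.

Lemma core_scale_eq A B c : c != 0 -> (forall v, A v = c *: B v) -> linmap B ->
  analytic_core A = analytic_core B.
Proof.
move=> c0 AB lB; apply/seteqP; split; first exact: core_scale AB lB.
apply: (@core_scale _ _ c^-1); first by rewrite invr_eq0.
  by move=> v; rewrite AB scalerA mulVf // scale1r.
by move=> a u v; rewrite !AB lB; vec_eq R[i] X; ring.
Qed.

End Operators.

(** * Operators of rank at most one *)

Section RankOne.
Variables (R : realType) (X : normedModType R[i]).
Implicit Types (T S : bop X) (f : X -> R[i]).
Local Notation C := R[i].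

Lemma in_span1 (x v : X) : in_span [:: x] v <-> exists a, v = a *: x.
Proof. by split=> -[a av]; exists a; [apply/subr0_eq | rewrite av /= subrr]. Qed.

Lemma in_span2 (x y v : X) :
  in_span [:: x; y] v <-> exists a b, v = a *: x + b *: y.
Proof.
split=> [[a [b /= /subr0_eq ab]]|[a [b ->]]]; exists a, b.
  by rewrite -ab addrC subrK.
by rewrite /=; vec_eq R[i] X; ring.
Qed.

Lemma in_span3 (x y z v : X) :
  in_span [:: x; y; z] v <-> exists a b c, v = a *: x + b *: y + c *: z.
Proof.
split=> [[a /in_span2[b [c bc]]]|[a [b [c ->]]]]; exists a.
  by exists b, c; rewrite -addrA -bc addrC subrK.
by apply/in_span2; exists b, c; vec_eq R[i] X; ring.
Qed.

Lemma free3_nspan2 (e0 e1 e2 x y : X) : lfree [:: e0; e1; e2] ->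
  in_span [:: x; y] e0 -> in_span [:: x; y] e1 -> in_span [:: x; y] e2 -> False.
Proof.
move=> fr /in_span2[a0 [b0 E0]] /in_span2[a1 [b1 E1]] /in_span2[a2 [b2 E2]].
have dual (c0 c1 c2 : C) :
    exists F G, [/\ a0 * F + b0 * G = c0, a1 * F + b1 * G = c1 & a2 * F + b2 * G = c2].
  have [f fb /= [f0 [f1 [f2 _]]]] := @form_interpolation _ _ [:: (e0, c0); (e1, c1); (e2, c2)] fr.
  by exists (f x), (f y); rewrite -f0 -f1 -f2 E0 E1 E2 !formD // !formZ.
have [F0 [G0 [p0 p1 p2]]] := dual 1 0 0.
have [F1 [G1 [q0 q1 q2]]] := dual 0 1 0.
have [F2 [G2 [r0 r1 r2]]] := dual 0 0 1.
(* The left side is the determinant of a product of a 3 by 2 and a 2 by 3 matrix, hence zero,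
   whereas the dual values make that product the identity. *)
have : (a0 * F0 + b0 * G0) * ((a1 * F1 + b1 * G1) * (a2 * F2 + b2 * G2)
         - (a2 * F1 + b2 * G1) * (a1 * F2 + b1 * G2))
     - (a1 * F0 + b1 * G0) * ((a0 * F1 + b0 * G1) * (a2 * F2 + b2 * G2)
         - (a2 * F1 + b2 * G1) * (a0 * F2 + b0 * G2))
     + (a2 * F0 + b2 * G0) * ((a0 * F1 + b0 * G1) * (a1 * F2 + b1 * G2)
         - (a1 * F1 + b1 * G1) * (a0 * F2 + b0 * G2)) = 0 by ring.
rewrite p0 p1 p2 q0 q1 q2 r0 r1 r2 !(mul0r, mulr0, mul1r, subr0, addr0).
by move/eqP; rewrite oner_eq0.
Qed.

Lemma coordinates2 (x y : X) (a b c d : C) : lfree [:: x; y] ->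
  a *: x + b *: y = c *: x + d *: y -> a = c /\ b = d.
Proof.
move=> fr E.
have [f fb [/= fx [fy _]]] := @form_interpolation _ _ [:: (x, 1); (y, 0)] fr.
have [g gb [/= gx [gy _]]] := @form_interpolation _ _ [:: (x, 0); (y, 1)] fr.
split; [move/(congr1 f): E | move/(congr1 g): E].
  by rewrite !formD // !formZ // fx fy !(mulr0, mulr1, addr0).
by rewrite !formD // !formZ // gx gy !(mulr0, mulr1, add0r).
Qed.

Lemma eigenvalues_eq T (x y : X) (a b c : C) : lfree [:: x; y] ->
  T x = a *: x -> T y = b *: y -> T (x + y) = c *: (x + y) -> a = b.
Proof.
move=> fr Tx Ty; rewrite bopD Tx Ty scalerDr => /(coordinates2 fr)[-> ->] //.
Qed.

(** Three independent vectors exclude a core contained in a plane, which is what a rank-one factor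
    would force. *)
Definition large_core A := exists e0 e1 e2 : X,
  lfree [:: e0; e1; e2] /\ forall v, in_span [:: e0; e1; e2] v -> analytic_core A v.

Lemma large_core_span A (e0 e1 e2 : X) : linmap A -> lfree [:: e0; e1; e2] ->
  (exists a b c, A (a *: e0 + b *: e1 + c *: e2) = e0) ->
  (exists a b c, A (a *: e0 + b *: e1 + c *: e2) = e1) ->
  (exists a b c, A (a *: e0 + b *: e1 + c *: e2) = e2) ->
  large_core A.
Proof.
move=> lA fr h0 h1 h2; exists e0, e1, e2; split=> //; apply: core_span => // y.
rewrite !inE => /or3P[] /eqP ->; [case: h0|case: h1|case: h2] => a [b [c abc]];
  by exists (a *: e0 + b *: e1 + c *: e2) => //; apply/in_span3; exists a, b, c.
Qed.

(** Let [S] lower [T (T x)] to [T x], [T x] to [x] and [x] to [0], with range in the span of [T x]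
    and [x]. Then TS+ST is triangular on the three vectors, with diagonal 1, 2, 1. *)
Lemma large_core_cyclic T (x : X) : ~ in_span [:: T x; x] (T (T x)) ->
  exists S, large_core (anticomm T S).
Proof.
move=> nx; have nx1 : ~ in_span [:: x] (T x).
  move=> /in_span1[a Tx]; apply: nx; apply/in_span2; exists a, 0.
  by rewrite {1}Tx bopZ scale0r addr0.
have nx0 : x <> 0 by move=> x0; apply: nx1; rewrite x0 bop0; exact: in_span0.
have fr : lfree [:: T (T x); T x; x] by [].
have [S /= [S2 [S1 [S0 _]]] rS] :=
  @bop_interpolation _ _ [:: (T (T x), T x); (T x, x); (x, 0)] fr.
have /in_span3[a [b [c]]] := rS (T (T (T x))); rewrite /= scaler0 addr0 => S3.
exists S; apply: (large_core_span (@anticomm_linear _ _ T S) fr).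
- exists 1, (- (a / 2)), (- b).
  by rewrite /anticomm !(bopE, S3, S2, S1, S0); vec_eq R[i] X; field.
- by exists 0, 2^-1, 0; rewrite /anticomm !(bopE, S3, S2, S1, S0); vec_eq R[i] X; field.
- by exists 0, 0, 1; rewrite /anticomm !(bopE, S3, S2, S1, S0); vec_eq R[i] X; field.
Qed.

(** When every vector is an eigenvector, independent vectors share one eigenvalue, nonzero here
    because [T b] is nonzero; the identity serves as [S]. *)
Lemma large_core_scalar T (a b : X) : infinite_dimensional X ->
  (forall x, in_span [:: x] (T x)) -> lfree [:: T a; T b] ->
  exists S, large_core (anticomm T S).
Proof.
move=> infX Tsc [nab [nb _]].
have eig x : exists c, T x = c *: x by apply/in_span1.
have nab0 : ~ in_span [:: b] a.
  by move=> /in_span1[k ak]; apply: nab; rewrite ak bopZ; apply/in_span1; exists k.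
have b0 : b <> 0 by move=> b0; apply: nb; rewrite b0 bop0.
have frab : lfree [:: a; b] by [].
have [e ne] := infinite_dimensional_nspan [:: a; b] infX.
have fr : lfree [:: e; a; b] by [].
have a0 : a <> 0 by move=> a0; apply: nab0; rewrite a0; exact: in_span0.
have frea : lfree [:: e; a].
  split=> //; move=> /in_span1[k ek]; apply: ne; apply/in_span2.
  by exists k, 0; rewrite scale0r addr0.
have [la Ta] := eig a; have [mu Tb] := eig b; have [ka Te] := eig e.
have [nu Tab] := eig (a + b); have [nu' Tea] := eig (e + a).
have E1 := eigenvalues_eq frab Ta Tb Tab; have E2 := eigenvalues_eq frea Te Ta Tea.
have mu0 : 2 * mu != 0.
  by rewrite mulf_neq0 //; apply/eqP => m0; apply: nb; rewrite Tb m0 scale0r.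
rewrite E1 in Ta; rewrite E2 E1 in Te.
have [S SP] := bop_id X; exists S.
by apply: (large_core_span (@anticomm_linear _ _ T S) fr);
   [exists (2 * mu)^-1, 0, 0|exists 0, (2 * mu)^-1, 0|exists 0, 0, (2 * mu)^-1];
   rewrite /anticomm !(SP, bopE, Ta, Tb, Te); vec_eq R[i] X; field;
   move: mu0; rewrite mulf_eq0 negb_or => /andP[].
Qed.

(** * Operators with an invariant plane spanned by [u] and [x] *)

Section InvariantPlane.
Variables (T : bop X) (x u : X) (al be : C).
Hypotheses (Tx : T x = u) (Tu : T u = be *: u + al *: x).
Hypothesis fr : lfree [:: u; x].

(** For this [S], TS+ST fixes [y] and [x] and sends [u] to [u + be *: x]. *)
Lemma large_core_plane4 (y : X) : ~ in_span [:: u; x] y ->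
  ~ in_span [:: y; u; x] (T y) -> exists S, large_core (anticomm T S).
Proof.
move=> ny nTy; have fr4 : lfree [:: T y; y; u; x] by split.
have [S /= [S3 [S2 [S1 [S0 _]]]] _] :=
  @bop_interpolation _ _ [:: (T y, y); (y, 0); (u, x); (x, 0)] fr4.
exists S; apply: (large_core_span (@anticomm_linear _ _ T S) fr4.2).
- by exists 1, 0, 0; rewrite /anticomm !(bopE, S3, S2, S1, S0, Tx, Tu); vec_eq R[i] X; ring.
- by exists 0, 1, (- be); rewrite /anticomm !(bopE, S3, S2, S1, S0, Tx, Tu); vec_eq R[i] X; ring.
- by exists 0, 0, 1; rewrite /anticomm !(bopE, S3, S2, S1, S0, Tx, Tu); vec_eq R[i] X; ring.
Qed.

(** For this [S], TS+ST is triangular on [y], [u], [x] with diagonal [2 * la], 1, 1. *)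
Lemma large_core_plane3 (y : X) (la p q : C) : ~ in_span [:: u; x] y -> la != 0 ->
  T y = la *: y + q *: u + p *: x -> exists S, large_core (anticomm T S).
Proof.
move=> ny la0 Ty; have fr3 : lfree [:: y; u; x] by split.
have [S /= [S2 [S1 [S0 _]]] _] :=
  @bop_interpolation _ _ [:: (y, y); (u, x); (x, 0)] fr3.
exists S; apply: (large_core_span (@anticomm_linear _ _ T S) fr3).
- exists (2 * la)^-1, (- q / (2 * la)), (- (2 * la)^-1 * (p + q) + be * q / (2 * la)).
  by rewrite /anticomm !(bopE, S2, S1, S0, Tx, Tu, Ty); vec_eq R[i] X; field.
- exists 0, 1, (- be).
  by rewrite /anticomm !(bopE, S2, S1, S0, Tx, Tu, Ty); vec_eq R[i] X; field.
- exists 0, 0, 1.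
  by rewrite /anticomm !(bopE, S2, S1, S0, Tx, Tu, Ty); vec_eq R[i] X; field.
Qed.

(** As [al] is nonzero, [T] is invertible on the plane, so [y] can be corrected to a kernel vector
    [z]. Then TS+ST sends [z] to [u], [u] to [al *: z + u + be *: x] and fixes [x]: its determinant
    is [- al]. *)
Lemma large_core_plane_kernel (y : X) (p q : C) : ~ in_span [:: u; x] y -> al != 0 ->
  T y = q *: u + p *: x -> exists S, large_core (anticomm T S).
Proof.
move=> ny al0 Ty; pose z := y - ((p / al) *: u + (q - p * be / al) *: x).
have Tz : T z = 0 by rewrite /z !bopE Ty Tx Tu; vec_eq R[i] X; field.
have nz : ~ in_span [:: u; x] z.
  move=> uz; apply: ny; rewrite -(subrK ((p / al) *: u + (q - p * be / al) *: x) y).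
  by apply: in_spanD => //; apply/in_span2; exists (p / al), (q - p * be / al).
have fr3 : lfree [:: z; u; x] by split.
have [S /= [S2 [S1 [S0 _]]] _] :=
  @bop_interpolation _ _ [:: (z, x); (u, x); (x, z)] fr3.
clearbody z; exists S; apply: (large_core_span (@anticomm_linear _ _ T S) fr3).
- exists (- al^-1), al^-1, (- (be / al)).
  by rewrite /anticomm !(bopE, S2, S1, S0, Tx, Tu, Tz); vec_eq R[i] X; field.
- exists 1, 0, 0.
  by rewrite /anticomm !(bopE, S2, S1, S0, Tx, Tu, Tz); vec_eq R[i] X; field.
- exists 0, 0, 1.
  by rewrite /anticomm !(bopE, S2, S1, S0, Tx, Tu, Tz); vec_eq R[i] X; field.
Qed.

(* If [al = 0] and [T c] has a component along [x], then [x = T y] for some [y], and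
   a quadratic relation at [y] would put [y] in the plane, whose image misses [x]. *)
Lemma plane_invertible (c : X) (c1 c2 : C) :
  (forall y, in_span [:: T y; y] (T (T y))) -> c1 != 0 ->
  T c = c2 *: u + c1 *: x -> al != 0.
Proof.
move=> quad c10 Tc; apply/eqP => al0.
have Tu0 : T u = be *: u by rewrite Tu al0 scale0r addr0.
pose y := c1^-1 *: (c - c2 *: x).
have Ty : T y = x by rewrite /y !bopE Tc Tx; vec_eq R[i] X; field.
have /in_span2[k [m]] := quad y; rewrite Ty Tx => um.
have m0 : m != 0.
  apply/eqP => m0; apply: fr.1; apply/in_span1; exists k.
  by rewrite um m0 scale0r addr0.
have ye : y = m^-1 *: (u - k *: x) by rewrite {1}um; vec_eq R[i] X; field.
have : 0 *: u + 1 *: x = (m^-1 * (be - k)) *: u + 0 *: x.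
  by rewrite -{1}Ty ye !bopE Tu0 Tx; vec_eq R[i] X; ring.
by move=> /(coordinates2 fr)[_ /eqP]; rewrite oner_eq0.
Qed.

End InvariantPlane.

(** A cyclic vector or a scalar [T] is settled directly. Otherwise some [x] and [u = T x] span an
    invariant plane, and if no [S] existed, [T] would map all of [X] into that plane; rank two then
    makes [al] nonzero, and a vector outside the plane yields an [S]. *)
Theorem large_core_of_rank2 T (a b : X) : infinite_dimensional X ->
  lfree [:: T a; T b] -> exists S, large_core (anticomm T S).
Proof.
move=> infX frab.
have [[x nx]|/forallNP quad0] := pselect (exists x, ~ in_span [:: T x; x] (T (T x))).
  exact: large_core_cyclic nx.
have quad x := contrapT (quad0 x).
have [[x nx]|/forallNP Tsc] := pselect (exists x, ~ in_span [:: x] (T x)); last first.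
  by apply: large_core_scalar infX _ frab => x; exact: contrapT.
have [be [al Tu]] := (in_span2 _ _ _).1 (quad x).
have x0 : x <> 0 by move=> x0; apply: nx; rewrite x0 bop0; exact: in_span0.
have [u Tx] : exists u, T x = u by eexists.
rewrite Tx in Tu nx; have fr : lfree [:: u; x] by [].
apply: contrapT => nS.
have inV y : ~ in_span [:: u; x] y -> in_span [:: u; x] (T y).
  move=> ny; have : in_span [:: y; u; x] (T y).
    by apply: contrapT => /(large_core_plane4 Tx Tu fr ny).
  move=> /in_span3[la [q [p Ty]]]; have [la0|la0] := eqVneq la 0.
    by apply/in_span2; exists q, p; rewrite Ty la0 scale0r add0r.
  by case: nS; exact: (large_core_plane3 Tx Tu fr ny la0 Ty).
have {}inV y : exists q p, T y = q *: u + p *: x.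
  have [/in_span2[q [p ->]]|/inV/in_span2 //] := pselect (in_span [:: u; x] y).
  exists (q * be + p), (q * al).
  by rewrite !bopE Tu Tx; vec_eq R[i] X; ring.
have al0 : al != 0.
  (* Independent [T a] and [T b] cannot both be multiples of [u], so one of them has a component
     along [x]. *)
  have [a2 [a1 Ta]] := inV a; have [b2 [b1 Tb]] := inV b.
  have [a10|a10] := eqVneq a1 0; last exact: (plane_invertible Tx Tu fr quad a10 Ta).
  have [b10|b10] := eqVneq b1 0; last exact: (plane_invertible Tx Tu fr quad b10 Tb).
  rewrite a10 b10 !scale0r !addr0 in Ta Tb; case: frab => nab [nb _].
  have b20 : b2 != 0 by apply/eqP => b20; apply: nb; rewrite Tb b20 scale0r.
  by case: nab; apply/in_span1; exists (a2 / b2); rewrite Ta Tb scalerA divfK.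
have [y ny] := infinite_dimensional_nspan [:: u; x] infX.
have [q [p Ty]] := inV y.
by apply: nS; exact: (large_core_plane_kernel Tx Tu fr ny al0 Ty).
Qed.

Lemma rank_le1 T : infinite_dimensional X ->
  (forall S, exists p q, analytic_core (anticomm T S) `<=` in_span [:: p; q]) ->
  forall a b, T b <> 0 -> exists k, T a = k *: T b.
Proof.
move=> infX small a b Tb; apply/in_span1; apply: contrapT => nab.
have [|S [e0 [e1 [e2 [fr eK]]]]] := @large_core_of_rank2 T a b infX; first by [].
have [p [q pq]] := small S.
apply: (free3_nspan2 fr (x := p) (y := q)); apply/pq/eK; apply/in_span3.
- by exists 1, 0, 0; vec_eq R[i] X; ring.
- by exists 0, 1, 0; vec_eq R[i] X; ring.
- by exists 0, 0, 1; vec_eq R[i] X; ring.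
Qed.

End RankOne.

(** The two roots have sum [b], so both vanish only if [b = 0], and then [c = 0]. The root serves as
    the value of a form at [T x] in [test_form]. *)
Lemma nonzero_quadratic_root (R : realType) (b c : R[i]) : (b != 0) || (c != 0) ->
  exists2 t : R[i], t != 0 & t ^+ 2 = b * t + c.
Proof.
move=> bc; pose s := sqrtc (b ^+ 2 + 4 * c).
have s2 : s ^+ 2 = b ^+ 2 + 4 * c by rewrite sqr_sqrtc.
have root t : t = (b + s) / 2 \/ t = (b - s) / 2 -> t ^+ 2 = b * t + c.
  have -> : c = (s ^+ 2 - b ^+ 2) / 4 by rewrite s2; field.
  by case=> ->; field.
have [t0|t0] := eqVneq ((b + s) / 2) 0; last by exists ((b + s) / 2) => //; apply: root; left.
have [t1|t1] := eqVneq ((b - s) / 2) 0; last by exists ((b - s) / 2) => //; apply: root; right.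
have b0 : b = 0.
  have -> : b = (b + s) / 2 + (b - s) / 2 by field.
  by rewrite t0 t1 addr0.
have := root 0 (or_introl (esym t0)); rewrite b0 expr0n mul0r add0r => c0.
by move: bc; rewrite b0 -c0 eqxx.
Qed.

(** * Tests against rank-one operators *)

Section RankOneTest.
Variables (R : realType) (X : normedModType R[i]).
Variables (T P : bop X) (f : X -> R[i]) (x : X).
Hypotheses (fb : bounded_form f) (fx : f x = 1) (PE : forall v, P v = f v *: x).
Let A := anticomm T P.
Let t := f (T x).
Let w := T x + t *: x.

Lemma rank1_testE v : A v = f v *: T x + f (T v) *: x.
Proof. by rewrite /A /anticomm !PE bopZ. Qed.

Lemma rank1_test_sub v : analytic_core A v -> in_span [:: T x; x] v.
Proof.
by move=> /(core_iter 1)[u /= <-]; apply/in_span2; exists (f u), (f (T u)); rewrite rank1_testE.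
Qed.

(** In coordinates along [T x] and [x], [A] has determinant [t ^+ 2 - f (T (T x))]; the witnesses
    solve the resulting 2 by 2 systems. *)
Lemma rank1_test_full v : f (T (T x)) != t ^+ 2 ->
  in_span [:: T x; x] v -> analytic_core A v.
Proof.
rewrite -subr_eq0; set d := f (T (T x)) => dt.
have Ac a b : A (a *: T x + b *: x) = (a * t + b) *: T x + (a * d + b * t) *: x.
  by rewrite rank1_testE !bopE !(formD _ _ fb) !(formZ _ _ fb) fx -/t -/d mulr1.
apply: core_span; first exact: anticomm_linear.
move=> y; rewrite !inE => /orP[] /eqP ->.
  pose a := - t / (d - t ^+ 2); exists (a *: T x + (1 - a * t) *: x).
    by apply/in_span2; exists a, (1 - a * t).
  by rewrite Ac; vec_eq R[i] X; rewrite /a; field.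
pose a := (d - t ^+ 2)^-1; exists (a *: T x + (- a * t) *: x).
  by apply/in_span2; exists a, (- a * t).
by rewrite Ac; vec_eq R[i] X; rewrite /a; field.
Qed.

Hypothesis deg : f (T (T x)) = t ^+ 2.

Lemma rank1_test_deg p q : A (p *: T x + q *: x) = (p * t + q) *: w.
Proof.
rewrite rank1_testE !bopE !(formD _ _ fb) !(formZ _ _ fb) fx deg -/t /w.
by vec_eq R[i] X; ring.
Qed.

(** [A] maps [X] into the span of [T x] and [x], and that span into the line of [w]. *)
Lemma rank1_test_deg_sub v : analytic_core A v -> exists k, v = k *: w.
Proof.
move=> /(core_iter 2)[u /= <-]; rewrite (rank1_testE u) rank1_test_deg.
by exists (f u * t + f (T u)).
Qed.

Lemma rank1_test_deg_eigen : A w = (2 * t) *: w.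
Proof.
by rewrite /w -{1}[T x]scale1r rank1_test_deg /w; vec_eq R[i] X; ring.
Qed.

Lemma rank1_test_deg_core : t != 0 -> analytic_core A w.
Proof.
move=> t0; apply: (core_eigen (c := 2 * t)); first exact: anticomm_linear.
  by rewrite mulf_neq0.
exact: rank1_test_deg_eigen.
Qed.

(** For [t = 0] the vector [w] is killed too, so the cube of [A] is zero. *)
Lemma rank1_test_deg0 v : t = 0 -> analytic_core A v -> v = 0.
Proof.
move=> t0 /(core_iter 3)[u /= <-]; rewrite (rank1_testE u) rank1_test_deg.
rewrite linmapZ; last exact: anticomm_linear.
by rewrite rank1_test_deg_eigen t0 !mulr0 scale0r scaler0.
Qed.

End RankOneTest.

(** * Equal tests force proportional operators *)

Section LocalToGlobal.
Variables (R : realType) (X : normedModType R[i]).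
Implicit Types (T P : bop X) (f : X -> R[i]).
Local Notation C := R[i].

Definition same_tests T T' := forall P f x, bounded_form f -> f x = 1 ->
  (forall v, P v = f v *: x) -> analytic_core (anticomm T P) = analytic_core (anticomm T' P).

Lemma same_tests_sym T T' : same_tests T T' -> same_tests T' T.
Proof. by move=> TT' P f x fb fx PE; rewrite (TT' P f x). Qed.

(** If [T (T x)] is independent of [T x] and [x], all three values can be 1. If [T (T x)] is
    [b *: T x + c *: x], the value [t] must solve [t ^+ 2 = b * t + c], which has a nonzero root
    unless [T (T x) = 0]. *)
Lemma test_form T x : ~ in_span [:: x] (T x) -> T (T x) = 0 \/
  exists f t, [/\ bounded_form f, f x = 1, f (T x) = t, t != 0 & f (T (T x)) = t ^+ 2].
Proof.
move=> nx; have x0 : x <> 0 by move=> x0; apply: nx; rewrite x0 bop0; exact: in_span0.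
have [/in_span2[b [c TTx]]|n3] := pselect (in_span [:: T x; x] (T (T x))); last first.
  have [f fb /= [f2 [f1 [f0 _]]]] := @form_interpolation _ _
    [:: (T (T x), 1); (T x, 1); (x, 1)] (conj n3 (conj nx (conj x0 I))).
  by right; exists f, 1; rewrite expr1n oner_neq0.
have [bc|] := boolP ((b != 0) || (c != 0)); last first.
  by rewrite negb_or !negbK => /andP[/eqP b0 /eqP c0]; left; rewrite TTx b0 c0 !scale0r addr0.
have [t t0 t2] := nonzero_quadratic_root bc.
have [f fb /= [f1 [f0 _]]] := @form_interpolation _ _
  [:: (T x, t); (x, 1)] (conj nx (conj x0 I)).
by right; exists f, t; split=> //; rewrite TTx formD // !formZ // f1 f0 t2 mulr1.
Qed.

Lemma same_tests_noneigen T T' x : same_tests T T' -> ~ in_span [:: x] (T x) ->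
  exists2 c, c != 0 & T' x = c *: T x.
Proof.
move=> TT' nx; have x0 : x <> 0 by move=> x0; apply: nx; rewrite x0 bop0; exact: in_span0.
have nk (p q : C) : p != 0 -> p *: T x = q *: x -> False.
  move=> p0 pq; apply: nx; apply/in_span1; exists (p^-1 * q).
  by rewrite -scalerA -pq scalerA mulVf // scale1r.
have [TTx|[f [t [fb fx ft t0 deg]]]] := test_form nx; last first.
  have [P PE] := bop_rank1 x fb; have K := TT' P f x fb fx PE.
  rewrite -ft in deg t0.
  have deg' : f (T' (T' x)) = f (T' x) ^+ 2.
    (* Otherwise [x] is in the core for [T'], hence a multiple of [T x + f (T x) *: x], against the
       independence of [x] and [T x]. *)
    apply/eqP/negPn/negP => nd.
    have : analytic_core (anticomm T' P) x.
      by apply: (rank1_test_full fb fx PE nd); exact/in_span_cons/in_span_head.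
    rewrite -K => /(rank1_test_deg_sub fb fx PE deg)[k]; rewrite scalerDr scalerA => xk.
    have [k0|k0] := eqVneq k 0; first by apply: x0; rewrite xk k0 mul0r !scale0r addr0.
    by apply: (nk k (1 - k * f (T x)) k0); rewrite scalerBl scale1r {2}xk addrK.
  have := rank1_test_deg_core fb fx PE deg t0.
  rewrite K => /(rank1_test_deg_sub fb fx PE deg')[s ws].
  have s0 : s != 0.
    apply/eqP => s0; apply: (nk 1 (- f (T x))); first exact: oner_neq0.
    by rewrite scale1r scaleNr; apply/eqP; rewrite -addr_eq0 ws s0 scale0r.
  (* Applying [f] to [ws] doubles both sides' values at [T x] and [T' x]; with this the multiples of
     [x] in [ws] cancel. *)
  have st : f (T x) = s * f (T' x).
    have := congr1 f ws; rewrite !(formD _ _ fb, formZ _ _ fb) fx => E.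
    have -> : f (T x) = (f (T x) + f (T x) * 1) / 2 by field.
    by rewrite E; field.
  exists s^-1; first by rewrite invr_eq0.
  have -> : T x = s *: T' x.
    by apply: (addIr (f (T x) *: x)); rewrite ws scalerDr scalerA -st.
  by rewrite scalerA mulVf // scale1r.
(* Case [T (T x) = 0]: a form with value 1 at [T x] gives a nondegenerate test, which places [T x]
   in the span of [T' x] and [x]. *)
have fr : lfree [:: T x; x] by [].
have [f fb /= [f1 [fx _]]] := @form_interpolation _ _ [:: (T x, 1); (x, 1)] fr.
have [P PE] := bop_rank1 x fb.
have : analytic_core (anticomm T P) (T x).
  apply: (rank1_test_full fb fx PE _ (in_span_head _ _)).
  by rewrite TTx (form0 fb) f1 expr1n eq_sym oner_neq0.
rewrite (TT' P f x fb fx PE) => /(rank1_test_sub PE)/in_span2[p [q Tx]].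
have p0 : p != 0.
  apply/eqP => p0; apply: (nk 1 q); first exact: oner_neq0.
  by rewrite scale1r {1}Tx p0 scale0r add0r.
(* A form vanishing at [T x] gives a zero core. This forces [g (T' x) = 0], and [g] then removes the
   component [q] along [x]. *)
have [g gb /= [g1 [gx _]]] := @form_interpolation _ _ [:: (T x, 0); (x, 1)] fr.
have [Q QE] := bop_rank1 x gb.
have deg : g (T (T x)) = g (T x) ^+ 2 by rewrite TTx (form0 gb) g1 expr0n.
have K0 v : analytic_core (anticomm T' Q) v -> v = 0.
  rewrite -(TT' Q g x gb gx QE); exact: (rank1_test_deg0 gb gx QE deg g1).
have deg' : g (T' (T' x)) = g (T' x) ^+ 2.
  apply/eqP/negPn/negP => nd; apply/x0/K0/(rank1_test_full gb gx QE nd).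
  exact/in_span_cons/in_span_head.
have gT' : g (T' x) = 0.
  apply/eqP/negPn/negP => nd; have := K0 _ (rank1_test_deg_core gb gx QE deg' nd).
  move=> /eqP; rewrite addr_eq0 => /eqP T'x.
  apply: (nk 1 (q - p * g (T' x))); first exact: oner_neq0.
  by rewrite scale1r {1}Tx {1}T'x; vec_eq R[i] X; ring.
have q0 : q = 0.
  by have := congr1 g Tx; rewrite !(formD _ _ gb, formZ _ _ gb) g1 gT' gx mulr0 add0r mulr1.
exists p^-1; first by rewrite invr_eq0.
by rewrite {1}Tx q0 scale0r addr0 scalerA mulVf // scale1r.
Qed.

(** A nonzero [l] puts [x] in the core for [T]; with [m = 0] the operator for [T'] has range in the
    line of [x] and kills [x], so its square is zero. *)
Lemma same_tests_eigen T T' x (l m : C) : same_tests T T' -> x <> 0 ->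
  T x = l *: x -> T' x = m *: x -> l != 0 -> m != 0.
Proof.
move=> TT' x0 Tx T'x l0; apply/eqP => m0.
have [f fb fx] : exists2 f, bounded_form f & f x = 1 by apply/separating_form/eqP.
have [P PE] := bop_rank1 x fb.
have : analytic_core (anticomm T P) x.
  apply: (core_eigen (c := 2 * l)); first exact: anticomm_linear.
    by rewrite mulf_neq0.
  by rewrite (rank1_testE _ PE) fx Tx formZ // fx; vec_eq R[i] X; ring.
rewrite (TT' P f x fb fx PE) => /(core_iter 2)[u /=]; rewrite !(rank1_testE _ PE) T'x m0 scale0r.
by rewrite !scaler0 !add0r bopZ T'x m0 !scale0r scaler0 (form0 fb) scale0r => /esym.
Qed.

Lemma same_tests_local T T' x : same_tests T T' -> exists2 c, c != 0 & T' x = c *: T x.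
Proof.
move=> TT'; have [nx|/contrapT/in_span1[l Tx]] := pselect (~ in_span [:: x] (T x)).
  exact: same_tests_noneigen.
have T'T := same_tests_sym TT'.
have [nx|/contrapT/in_span1[m T'x]] := pselect (~ in_span [:: x] (T' x)).
  have [c c0 ->] := same_tests_noneigen T'T nx.
  by exists c^-1; rewrite ?invr_eq0 // scalerA mulVf // scale1r.
have [->|/eqP x0] := eqVneq x 0; first by exists 1; rewrite ?oner_neq0 // !bop0 scaler0.
have [l0|l0] := eqVneq l 0.
  have [m0|m0] := eqVneq m 0.
    by exists 1; rewrite ?oner_neq0 // Tx T'x l0 m0 !scale0r scaler0.
  by have := same_tests_eigen T'T x0 T'x Tx m0; rewrite l0 eqxx.
have m0 := same_tests_eigen TT' x0 Tx T'x l0.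
by exists (m / l); rewrite ?mulf_neq0 ?invr_eq0 // Tx T'x scalerA divfK.
Qed.

(** Fix [u] with [T u] nonzero. If [T x] is [s *: T u], then [x - s *: u] is killed by [T], hence by
    [T']; otherwise the factors at [x], [u] and [x + u] agree by comparing coefficients. *)
Lemma locally_proportional T T' : (forall x, exists2 c, c != 0 & T' x = c *: T x) ->
  exists2 c, c != 0 & forall x, T' x = c *: T x.
Proof.
move=> loc; have [[u Tu]|/forallNP T0] := pselect (exists u, T u <> 0); last first.
  exists 1; first exact: oner_neq0; move=> x; have [c _ ->] := loc x.
  by rewrite (contrapT (T0 x)) !scaler0.
have [c c0 T'u] := loc u; exists c => // x.
have [/in_span1[s Tx]|nx] := pselect (in_span [:: T u] (T x)).
  have [d _] := loc (x - s *: u); rewrite !bopE Tx subrr scaler0 T'u => /subr0_eq ->.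
  by rewrite !scalerA mulrC.
have [c1 _ T'x] := loc x; have [c2 _] := loc (x + u).
rewrite !bopD scalerDr T'x T'u.
have fr : lfree [:: T x; T u] by [].
by move=> /(coordinates2 fr)[-> ->].
Qed.

End LocalToGlobal.

(** * The action of the preserver on rank-one operators *)

Section Preserver.
Variables (R : realType) (X : normedModType R[i]) (phi : bop X -> bop X).
Hypothesis infX : infinite_dimensional X.
Hypothesis phi_surj : forall S : bop X, exists T : bop X, phi T = S.
Hypothesis phi_core : forall T S : bop X,
  analytic_core (anticomm (phi T) (phi S)) = analytic_core (anticomm T S).
Implicit Types (P : bop X) (f : X -> R[i]).

(** By surjectivity every core tested against [phi P] is a core tested against [P], so it lies in a
    plane and [phi P] has rank at most one. *)
Lemma preserver_rank1_range P f x : bounded_form f -> f x != 0 ->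
  (forall v, P v = f v *: x) ->
  exists2 g : X -> R[i], g x != 0 & forall v, phi P v = g v *: x.
Proof.
move=> fb fx PE.
have x0 : x <> 0 by move=> x0; move: fx; rewrite x0 form0 // eqxx.
have small S : exists p q, analytic_core (anticomm (phi P) S) `<=` in_span [:: p; q].
  have [S' <-] := phi_surj S; rewrite phi_core; exists x, (S' x).
  move=> v /(core_iter 1)[u /= <-]; apply/in_span2; exists (f (S' u)), (f u).
  by rewrite /anticomm !PE bopZ.
have : analytic_core (anticomm P P) x.
  apply: (core_eigen (c := 2 * f x ^+ 2)); first exact: anticomm_linear.
    by rewrite mulf_neq0 // expf_neq0.
  by rewrite /anticomm !PE formZ //; vec_eq R[i] X; ring.
(* Transporting the core places [x] in the range of [phi P], so that range is the line of [x];
   applying [phi P] twice gives [x], so [g x] is nonzero. *)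
rewrite -phi_core => /(core_iter 1)[u /=]; rewrite /anticomm -bopD.
set y := phi P u + phi P u => yx.
have rng v : exists k, phi P v = k *: x.
  by rewrite -yx; apply: rank_le1 infX small _ _ _; rewrite yx.
have [g gE] := choice rng; exists g => //; apply/eqP => gx; apply: x0.
by rewrite -yx /y bopD (gE u) bopZ (gE x) gx scale0r scaler0 addr0.
Qed.

(** It suffices that the kernel of [g] lies in that of [f]. If [g z = 0] and [f z] is nonzero, test
    with the operator [S] given by [f] and [z]: PS+SP has a nonzero eigenvalue, while its
    counterpart under [phi] squares to zero. *)
Lemma preserver_rank1 P f x : bounded_form f -> f x = 1 -> (forall v, P v = f v *: x) ->
  exists2 c, c != 0 & forall v, phi P v = c *: P v.
Proof.
move=> fb fx PE; have fx0 : f x != 0 by rewrite fx oner_neq0.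
have x0 : x != 0 by apply/eqP => x0; move: fx0; rewrite x0 form0 // eqxx.
have [g gx gE] := preserver_rank1_range fb fx0 PE.
have ker z : g z = 0 -> f z = 0.
  move=> gz; apply/eqP/negPn/negP => fz.
  have [S SE] := bop_rank1 z fb; have [h _ hE] := preserver_rank1_range fb fz SE.
  (* The eigenvector of PS+SP for the eigenvalue [2 * f z]. *)
  pose v := f z *: x + z.
  have fv : f v = 2 * f z by rewrite /v formD // formZ // fx; ring.
  have : analytic_core (anticomm P S) v.
    apply: (core_eigen (c := 2 * f z)); first exact: anticomm_linear.
      by rewrite mulf_neq0.
    rewrite /anticomm !(SE, PE) !formZ // fx fv /v.
    by vec_eq R[i] X; ring.
  have AE y : anticomm (phi P) (phi S) y = (g y * h x) *: z.
    by rewrite /anticomm (hE y) (gE y) !bopZ (gE z) (hE x) gz scale0r scaler0 add0r scalerA.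
  rewrite -phi_core => /(core_iter 2)[u /=]; rewrite (AE u) linmapZ; last exact: anticomm_linear.
  rewrite AE gz mul0r scale0r scaler0 => v0.
  by move: fv; rewrite -v0 form0 // => /esym/eqP; rewrite mulf_eq0 (negbTE fz) orbF pnatr_eq0.
exists (g x) => // v; rewrite PE gE scalerA; congr (_ *: _).
have gk : g (v - (g v / g x) *: x) = 0.
  have : phi P (v - (g v / g x) *: x) = 0.
    by rewrite !bopE !gE; vec_eq R[i] X; field.
  by rewrite gE => /eqP; rewrite scaler_eq0 (negbTE x0) orbF => /eqP.
have := ker _ gk; rewrite formD // formN // formZ // fx mulr1 => /subr0_eq ->.
by field.
Qed.

(** Since [phi P] is a nonzero multiple of [P], testing [phi T] against [phi P] or against [P] gives
    the same core. *)
Lemma preserver_same_tests (T : bop X) : same_tests T (phi T).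
Proof.
move=> P f x fb fx PE; have [c c0 cE] := preserver_rank1 fb fx PE.
rewrite -phi_core; apply: (core_scale_eq c0); last exact: anticomm_linear.
by move=> v; rewrite /anticomm !cE bopZ scalerDr.
Qed.

End Preserver.

Theorem theorem3p1 (R : realType) (X : completeNormedModType R[i])
  (hX : infinite_dimensional X) (phi : bop X -> bop X)
  (hsurj : forall S : bop X, exists T : bop X, phi T = S) :
  (forall T S : bop X,
     analytic_core (anticomm (phi T) (phi S)) = analytic_core (anticomm T S))
  <->
  (exists gamma : bop X -> R[i],
     (forall T, gamma T != 0) /\ (forall (T : bop X) (x : X), phi T x = gamma T *: T x)).
Proof.
split=> [phi_core|[gamma [gamma0 phiE]] T S].
  have scal T : exists c, c != 0 /\ forall x, phi T x = c *: T x.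
    have tests := preserver_same_tests hX hsurj phi_core T.
    have [c c0 cE] := locally_proportional (fun x => same_tests_local x tests).
    by exists c.
  have [gamma gammaP] := choice scal.
  by exists gamma; split=> T; [exact: (gammaP T).1 | exact: (gammaP T).2].
apply: (@core_scale_eq _ _ _ _ (gamma T * gamma S)); first by rewrite mulf_neq0.
  by move=> v; rewrite /anticomm !phiE !bopZ; vec_eq R[i] X; ring.
exact: anticomm_linear.
Qed.
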